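(* Every compact countably bisequential topological space is $\omega_1$-sequentially compact.
   Context: A family $\mathcal{U}$ of subsets of a space $X$ clusters at $x\in X$ if $x\in\overline{U}$ for every $U\in\mathcal{U}$. A space $X$ is countably bisequential if for every ultrafilter $\mathcal{U}$ on a countable subset of $X$ and every $x\in X$ at which $\mathcal{U}$ clusters, there is a countable subfamily $\{A_n:n\in\omega\}\subseteq\mathcal{U}$ converging to $x$, i.e. such that every open neighborhood $W$ of $x$ contains some $A_n$. For sets of naturals, $s\sqsubseteq t$ means $s$ is an initial segment of $t$. For $\mathcal{F}\subseteq[\omega]^{<\omega}$ and $M\subseteq\omega$ let $\mathcal{F}|M=\{s\in\mathcal{F}:s\subseteq M\}$. A barrier on an infinite set $M\subseteq\omega$ is a family $\mathcal{B}$ of finite subsets of $M$ such that (a) $s\subseteq t$ implies $s=t$ for $s,t\in\mathcal{B}$, and (b) every infinite $N\subseteq M$ has an initial segment $s\sqsubseteq N$ with $s\in\mathcal{B}$. Every barrier has a rank: $T(\mathcal{B})=\{s\in[\omega]^{<\omega}:\exists t\in\mathcal{B}\,(s\sqsubseteq t)\}$, $\rho_{T(\mathcal{B})}(s)=\sup\{\rho_{T(\mathcal{B})}(t)+1:t\in T(\mathcal{B}),\ s\sqsubseteq t,\ s\neq t\}$ (with $\sup\emptyset=0$), and $\rho(\mathcal{B})=\rho_{T(\mathcal{B})}(\emptyset)<\omega_1$. If $\mathcal{B}$ is a barrier on an infinite set $M$, $f:\mathcal{B}\to X$ converges to $x\in X$ if for every open $U\ni x$ there is $n\in\omega$ with $f[\mathcal{B}|(M\setminus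 n)]\subseteq U$. For a barrier $\mathcal{B}$ on $\omega$, $X$ is $\mathcal{B}$-sequentially compact if for every $f:\mathcal{B}\to X$ there is an infinite $M\subseteq\omega$ such that $f\restriction(\mathcal{B}|M)$ converges to some point of $X$. For $\alpha<\omega_1$, $X$ is $\alpha$-sequentially compact if it is $\mathcal{B}$-sequentially compact for all barriers $\mathcal{B}$ on $\omega$ of rank $\alpha$; $X$ is $\omega_1$-sequentially compact if it is $\alpha$-sequentially compact for every $\alpha<\omega_1$. *)

(* Defs.v *)
From mathcomp Require Import all_boot finmap.
From mathcomp Require Import all_classical topology.

Set Implicit Arguments.
Unset Strict Implicit.
Unset Printing Implicit Defensive.

Local Open Scope classical_set_scope.

(* Countable ordinals. [csup a] denotes the supremum of b + 1 over all b such
   that a n = Some b for some n. Every countable ordinal is the supremum of the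
   successors of its elements, so each is denoted by some term; terms denoting
   the same ordinal are identified by [ceq]. *)
Inductive cord : Type := csup of (nat -> option cord).

Fixpoint cle (a b : cord) {struct a} : Prop :=
  let: csup f := a in
  forall n, match f n with
            | None => True
            | Some x => let: csup g := b in
                exists m, match g m with
                          | None => False
                          | Some y => cle x y
                          end
            end.

Definition ceq (a b : cord) : Prop := cle a b /\ cle b a.

(* sup {rho t + 1 : t in D}; finite sets of naturals are enumerated by
   [choice.unpickle]. *)
Definition sup_succ (D : set {fset nat}) (rho : {fset nat} -> cord) : cord :=
  csup (fun n => if choice.unpickle n is Some t then
                   if `[< D t >] then Some (rho t) else None
                 else None).

Definition initial_segment (s t : set nat) : Prop :=
  s `<=` t /\ forall k m, s k -> t m -> (m <= k)%N -> s m.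

Definition restrict_family (F : set {fset nat}) (M : set nat) :
    set {fset nat} :=
  [set s | F s /\ [set` s] `<=` M].

Definition barrier (M : set nat) (B : set {fset nat}) : Prop :=
  [/\ infinite_set M,
      forall s, B s -> [set` s] `<=` M,
      forall s t, B s -> B t -> (s `<=` t)%fset -> s = t &
      forall N : set nat, N `<=` M -> infinite_set N ->
        exists2 s, B s & initial_segment [set` s] N].

Definition tree_of (B : set {fset nat}) : set {fset nat} :=
  [set s | exists2 t, B t & initial_segment [set` s] [set` t]].

Definition proper_extensions (T : set {fset nat}) (s : {fset nat}) :
    set {fset nat} :=
  [set t | [/\ T t, initial_segment [set` s] [set` t] & s <> t]].

Definition is_tree_rank (T : set {fset nat}) (rho : {fset nat} -> cord) :
    Prop :=
  forall s, T s -> ceq (rho s) (sup_succ (proper_extensions T s) rho).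

(* By [barrier_has_rank] and [has_rank_unique] below, every barrier has exactly
   one rank up to [ceq]. *)
Definition has_rank (B : set {fset nat}) (alpha : cord) : Prop :=
  exists2 rho, is_tree_rank (tree_of B) rho & ceq (rho fset0) alpha.

(* Functions B -> X are represented by total functions on finite sets, of which
   only the values on B matter; if B is a barrier, then B is nonempty, so no
   generality is lost, even for empty X. *)
Definition barrier_cvg (X : topologicalType) (M : set nat)
    (B : set {fset nat}) (f : {fset nat} -> X) (x : X) : Prop :=
  forall U : set X, open U -> U x ->
    exists n : nat,
      f @` restrict_family B (M `\` [set k | (k < n)%N]) `<=` U.

Definition barrier_seq_compact (B : set {fset nat}) (X : topologicalType) :
    Prop :=
  forall f : {fset nat} -> X, exists2 M : set nat, infinite_set M &
    exists x : X, barrier_cvg M (restrict_family B M) f x.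

Definition ord_seq_compact (alpha : cord) (X : topologicalType) : Prop :=
  forall B : set {fset nat}, barrier [set: nat] B -> has_rank B alpha ->
    barrier_seq_compact B X.

Definition omega1_seq_compact (X : topologicalType) : Prop :=
  forall alpha : cord, ord_seq_compact alpha X.

Definition clusters_at (X : topologicalType) (U : set_system X) (x : X) :
    Prop :=
  forall A, U A -> closure A x.

(* An ultrafilter on a subset D of X is a set system on the type of the elements
   of D, and its members are carried to subsets of X by [set_val]. *)
Definition countably_bisequential (X : topologicalType) : Prop :=
  forall (D : set X) (U : set_system D), countable D -> UltraFilter U ->
    forall x : X, clusters_at [set set_val @` A | A in U] x ->
    exists2 A : nat -> set D, (forall n, U (A n)) &
      forall W : set X, open W -> W x -> exists n, set_val @` A n `<=` W.


Lemma cle_refl a : cle a a.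
Proof.
move: a; fix IH 1; case=> f n; case E: (f n) => [x|] //.
by exists n; rewrite E; case: (f n) E => // y [<-]; exact: IH.
Qed.

Lemma cle_trans b a c : cle a b -> cle b c -> cle a c.
Proof.
move: a b c; fix IH 1; case=> f [g] [h] fg gh n; move: (fg n).
case: (f n) => [x|] // [m]; case E: (g m) => [y|] // xy.
move: (gh m); rewrite E => -[k]; case Ek: (h k) => [z|] // yz.
by exists k; rewrite Ek; exact: (IH x y z xy yz).
Qed.

Lemma ceq_refl a : ceq a a.
Proof. by split; exact: cle_refl. Qed.

Lemma ceq_sym a b : ceq a b -> ceq b a.
Proof. by case. Qed.

Lemma ceq_trans b a c : ceq a b -> ceq b c -> ceq a c.
Proof. by move=> [ab ba] [bc cb]; split; apply: (@cle_trans b). Qed.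

Lemma sup_succ_ceq D rho rho' : (forall t, D t -> ceq (rho t) (rho' t)) ->
  ceq (sup_succ D rho) (sup_succ D rho').
Proof.
suff H r r' : (forall t, D t -> ceq (r t) (r' t)) ->
    cle (sup_succ D r) (sup_succ D r').
  by move=> rr; split; apply: H => // t /rr/ceq_sym.
move=> rr n; case E: (choice.unpickle n) => [t|] //.
by case: asboolP => // Dt; exists n; rewrite E asboolT //; case: (rr t Dt).
Qed.

Lemma initial_segment_trans t s u :
  initial_segment s t -> initial_segment t u -> initial_segment s u.
Proof.
move=> [st st'] [tu tu']; split; first exact: subset_trans tu.
by move=> k m sk um mk; apply: (st' k) => //; apply: (tu' k) => //; exact: st.
Qed.

Lemma barrier_tree_wf M B : barrier M B ->
  well_founded (fun t s => tree_of B s /\ proper_extensions (tree_of B) s t).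
Proof.
move=> [_ BM Banti Binit]; set R := (fun t s => _) => s0.
apply: contrapT => nA0.
have nextS (s : {s | ~ Acc R s}) : {t : {s | ~ Acc R s} | R (sval t) (sval s)}.
  case: s => s nA /=; apply: cid; apply: contrapT => nx; apply: nA.
  by split=> t Rts; apply: contrapT => nAt; apply: nx; exists (exist _ t nAt).
have [w [_ wR]] := @dependent_choice _ _ nextS (exist _ s0 nA0).
pose u n := sval (w n).
have uT n : tree_of B (u n) by case: (wR n).
have uS n : initial_segment [set` u n] [set` u n.+1] by case: (wR n) => _ [].
have uN n : u n <> u n.+1 by case: (wR n) => _ [].
have u_mono n m : (n <= m)%N -> initial_segment [set` u n] [set` u m].
  move=> /subnK <-; elim: (m - n)%N => [|k IH]; first by split.
  by rewrite addSn; exact: initial_segment_trans (uS _).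
have u_card n : (n <= #|` u n|)%N.
  elim: n => // n IH; apply: (leq_ltn_trans IH); apply: fproper_ltn_card.
  rewrite fproperEneq; apply/andP; split; first by apply/eqP.
  by apply/fsubsetP => x; case: (uS n) => + _ => /(_ x).
pose N := \bigcup_n [set` u n].
have uNi n : initial_segment [set` u n] N.
  split; first by move=> x; exists n.
  move=> k m uk [p _ um] mk.
  have [np|/ltnW pn] := leqP n p; first by apply: (u_mono _ _ np).2 uk um mk.
  by apply: (u_mono _ _ pn).1.
have NM : N `<=` M.
  move=> x [n _ ux]; have [t Bt [st _]] := uT n.
  exact: (BM _ Bt) (st _ ux).
have Ninf : infinite_set N.
  move=> /finite_fsetP[X NX].
  have : (u #|` X|.+1 `<=` X)%fset.
    by apply/fsubsetP => x ux; suff: [set` X] x by []; rewrite -NX; case: (uNi #|` X|.+1) => + _; apply.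
  by move=> /fsubset_leq_card/(leq_trans (u_card _)); rewrite ltnn.
have [s Bs [sN sN']] := Binit N NM Ninf.
set n := #|` s|.+1.
have /fsubsetPn[x ux xs] : ~~ (u n `<=` s)%fset.
  by apply/negP => /fsubset_leq_card/(leq_trans (u_card _)); rewrite ltnn.
have su : (s `<=` u n)%fset.
  apply/fsubsetP => k sk.
  have [kx|/ltnW xk] := leqP k x; first by apply: (uNi n).2 ux (sN _ sk) kx.
  by move/negP: xs; case; apply: (sN' k) => //; exact: (uNi n).1.
have [t Bt [ut _]] := uT n.
have st : s = t.
  by apply: Banti => //; apply/fsubsetP => k /(fsubsetP su); exact: ut.
by move/negP: xs; apply; rewrite st; exact: ut.
Qed.

Lemma barrier_has_rank M B : barrier M B -> exists alpha, has_rank B alpha.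
Proof.
move=> bB; have wfR := barrier_tree_wf bB.
set R := (fun t s => _) in wfR.
pose F s (rec : forall t, R t s -> cord) := csup (fun n =>
  if choice.unpickle n is Some t then
    if pselect (R t s) is left h then Some (rec t h) else None
  else None).
pose rho := Fix wfR (fun=> cord) F.
exists (rho fset0), rho; last exact: ceq_refl.
move=> s Ts; rewrite /rho Fix_eq; last first.
  move=> x f g fg; congr F; apply: functional_extensionality_dep => y.
  by apply: functional_extensionality_dep => h; exact: fg.
rewrite /F /sup_succ.
set f := (fun n => _); set g := (fun n => _); suff -> : f = g.
  exact: ceq_refl.
apply/funext => n; rewrite /f /g; case: (choice.unpickle n) => [t|] //.
case: pselect => [[_ h]|h]; first by rewrite asboolT.
by rewrite asboolF // => h'; apply: h; split.
Qed.

Lemma has_rank_unique M B alpha beta :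
  barrier M B -> has_rank B alpha -> has_rank B beta -> ceq alpha beta.
Proof.
move=> bB [r rP r0] [r' rP' r0'].
have H s : tree_of B s -> ceq (r s) (r' s).
  elim/(well_founded_ind (barrier_tree_wf bB)): s => s IH Ts.
  apply: (ceq_trans (rP s Ts)); apply: ceq_trans (ceq_sym (rP' s Ts)).
  by apply: sup_succ_ceq => t st; apply: IH => //; case: st.
have T0 : tree_of B fset0.
  have [Minf _ _ Binit] := bB.
  have [s Bs _] := Binit M (fun _ => id) Minf.
  by exists s => //; split => [k|k m]; rewrite /= inE.
apply: ceq_trans r0'; apply: ceq_trans (H _ T0); exact: ceq_sym.
Qed.

(* Main.v *)
Require Import Defs.
From mathcomp Require Import all_boot finmap.
From mathcomp Require Import all_classical topology.

Local Open Scope classical_set_scope.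

(** Fix a nonprincipal ultrafilter [U] on the naturals. Iterating [U]-limits
    along the tree of a barrier [B] yields an ultrafilter [V] on [B]: a set [S]
    belongs to [V] if [U]-many first elements, followed by [U]-many second
    elements, and so on, lead to a member of [S] when [B] is reached.
    Compactness makes the image of [V] under [f] cluster at some [x], and countable
    bisequentiality provides sets [S n] in [V] whose images converge to [x].
    Choosing the elements of [M] one by one, each in the finitely many members
    of [U] demanded by the earlier choices, gives an infinite [M] such that, for
    every [n], all members of [B] that are contained in [M] and start far
    enough out belong to [S n]. *)

Lemma infinite_set_unbounded (N : set nat) :
  (forall p, exists2 k, N k & (p < k)%N) -> infinite_set N.
Proof.
move=> Nunb /finite_fsetP[F NF].
have [k Nk] := Nunb (\max_(i <- F) i)%N.
suff /leq_gtF -> : (k <= \max_(i <- F) i)%N by [].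
by apply: leq_bigmax_seq => //; rewrite NF in Nk.
Qed.

(** A finer proper filter with a member [A] outside [F] would also contain the complement of [A],
    hence the empty set. *)
Lemma decisive_ultra (T : Type) (F : set_system T) : ProperFilter F ->
  (forall A, F A \/ F (~` A)) -> UltraFilter F.
Proof.
move=> FF Fdec; split=> // G GF FG; apply/seteqP; split=> // A GA.
have [//|/FG GnA] := Fdec A.
by have /filter_ex[x []] : G (A `&` ~` A) by exact: filterI.
Qed.

(** Some [u] in [B] begins the set made of [s] and all numbers from [k] on. If [u] contains [k], it
    starts with [s] followed by [k]; otherwise [u] lies in [s], and the antichain property forces
    [s] into [B]. *)
Lemma tree_of_step (B : set {fset nat}) (s : {fset nat}) (k : nat) :
  barrier [set: nat] B -> tree_of B s -> ~ B s ->
  (forall i, i \in s -> (i < k)%N) -> tree_of B (k |` s)%fset.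
Proof.
move=> [_ _ Banti Binit] [t Bt [st _]] nBs sk.
pose N := [set i | i \in s \/ (k <= i)%N].
have Ninf : infinite_set N.
  apply: infinite_set_unbounded => p; exists (k + p.+1)%N.
    by right; exact: leq_addr.
  by rewrite addnS ltnS leq_addl.
have [u Bu [uN Nu]] := Binit N (fun _ _ => I) Ninf.
have [ku|kNu] := boolP (k \in u).
  exists u => //; split=> [i|i m] /=; rewrite !inE.
    by case/predU1P => [->//|si]; apply: (Nu k) => //; [left|exact/ltnW/sk].
  move=> iks um mi; case: (uN m um) => [->|km]; first by rewrite orbT.
  have ik : (i <= k)%N by case/predU1P: iks => [->|/sk/ltnW].
  by rewrite eqn_leq km (leq_trans mi ik).
have us i : i \in u -> i \in s.
  move=> ui; case: (uN i ui) => // ki; case/negP: kNu.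
  by apply: (Nu i) => //; right.
have ut : u = t by apply: Banti => //; apply/fsubsetP => i /us; exact: st.
case: nBs; suff -> : s = t by [].
apply/fsetP => i; apply/idP/idP => [/st//|]; rewrite -ut; exact: us.
Qed.

(* [large U B S s]: for [U]-many k_1, [U]-many k_2, ..., the set
   s, k_1, k_2, ... lies in [S] as soon as it lies in [B]. The set [A] is there
   for strict positivity. *)
Inductive large (U : set_system nat) (B S : set {fset nat}) :
    {fset nat} -> Prop :=
| large_leaf s : B s -> S s -> large U B S s
| large_node s A : ~ B s -> U A ->
    (forall k, A k -> large U B S (k |` s)%fset) -> large U B S s.

Lemma large_leafP U B S s : large U B S s -> B s -> S s.
Proof. by case. Qed.

Lemma large_nodeP U B S s : Filter U -> large U B S s -> ~ B s ->
  U [set k | large U B S (k |` s)%fset].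
Proof. by move=> FU [//|{}s A _ UA AS _]; exact: filterS UA. Qed.

Lemma largeS U B S S' s : S `<=` S' -> large U B S s -> large U B S' s.
Proof.
move=> SS'; elim=> [{}s Bs /SS'|{}s A nBs UA _ IH]; first exact: large_leaf.
exact: large_node UA IH.
Qed.

Lemma largeI U B S S' s : Filter U -> large U B S s -> large U B S' s ->
  large U B (S `&` S') s.
Proof.
move=> FU; elim=> [{}s Bs Ss|{}s A nBs UA _ IH] LS'.
  by apply: large_leaf => //; split=> //; exact: large_leafP LS' Bs.
have UA' := large_nodeP _ _ _ _ FU LS' nBs.
by apply: large_node nBs (filterI UA UA') _ => k [Ak]; exact: IH.
Qed.

Lemma large_set0 U B s : ProperFilter U -> ~ large U B set0 s.
Proof.
by move=> PU; elim=> // {}s A _ /filter_ex[k Ak] _; apply; exact: Ak.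
Qed.

Lemma large_decisive U B S s : barrier [set: nat] B -> UltraFilter U ->
  (forall p, U [set k | (p < k)%N]) -> tree_of B s ->
  large U B S s \/ large U B (~` S) s.
Proof.
move=> bB UU Uinf; elim/(well_founded_ind (barrier_tree_wf bB)): s => s IH Ts.
have FU : Filter U by exact: ultra_proper.
have [Bs|nBs] := pselect (B s).
  by have [Ss|nSs] := pselect (S s); [left|right]; exact: large_leaf.
(* Numbers above [p] end-extend [s], so the induction hypothesis applies to them. For empty [s] the
   default 0 merely discards [k = 0]. *)
set p := (\max_(i <- s) i)%N.
have sp i : i \in s -> (i <= p)%N by move=> si; exact: leq_bigmax_seq.
have step k : (p < k)%N ->
    large U B S (k |` s)%fset \/ large U B (~` S) (k |` s)%fset.
  move=> pk.
  have sk i : i \in s -> (i < k)%N by move=> /sp/leq_ltn_trans; exact.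
  have Tks := tree_of_step _ _ _ bB Ts nBs sk.
  apply: IH => //; split=> //; split=> //.
    split=> [i|i m]; rewrite /= !inE; first by move=> ->; rewrite orbT.
    by move=> /sk ik /predU1P[-> /(leq_trans ik)|//]; rewrite ltnn.
  move=> sks; have : k \in s by rewrite sks !inE eqxx.
  by move=> /sk; rewrite ltnn.
have [UA|UA] := in_ultra_setVsetC [set k | large U B S (k |` s)%fset] UU.
  by left; apply: large_node nBs UA _.
right; apply: large_node nBs (filterI (Uinf p) UA) _ => k [/step[]] //.
Qed.

Lemma tree_of_fset0 B : barrier [set: nat] B -> tree_of B fset0.
Proof.
move=> [Minf _ _ Binit]; have [s Bs _] := Binit [set: nat] (fun _ => id) Minf.
by exists s => //; split=> [k|k m]; rewrite /= inE.
Qed.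

Lemma large_ultra U B : barrier [set: nat] B -> UltraFilter U ->
  (forall p, U [set k | (p < k)%N]) ->
  UltraFilter [set S | large U B S fset0].
Proof.
move=> bB UU Uinf; have T0 := tree_of_fset0 _ bB.
have PU : ProperFilter U by exact: ultra_proper.
apply: decisive_ultra => [|A]; last exact: large_decisive.
split; first exact: large_set0.
split=> [|P Q|P Q]; [|exact: largeI|exact: largeS].
have [//|] := large_decisive U B setT _ bB UU Uinf T0.
by rewrite setCT => /large_set0 [].
Qed.

(* [U] need not be Ramsey or a P-point, since the members of [U] to be met at a
   given stage depend on finitely many earlier choices only. *)
Lemma large_diagonal U B (S : nat -> set {fset nat}) :
  barrier [set: nat] B -> ProperFilter U ->
  (forall p, U [set k | (p < k)%N]) -> (forall n, large U B (S n) fset0) ->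
  exists2 M : set nat, infinite_set M &
    forall n, exists p,
      restrict_family B (M `\` [set k | (k < p)%N]) `<=` S n.
Proof.
move=> [_ _ Banti _] PU Uinf S0.
(* A [k] that may follow [p] in [M]: it keeps every large node with elements up to [p] large, for
   each of [S 0], ..., [S p]. *)
pose demand p k := forall n s, (n <= p)%N ->
  (forall i, i \in s -> (i <= p)%N) ->
  large U B (S n) s -> ~ B s -> large U B (S n) (k |` s)%fset.
have next p : {k | (p < k)%N /\ demand p k}.
  apply: cid; suff : U ([set k | (p < k)%N] `&` demand p) by exact: filter_ex.
  apply: filterI; first exact: Uinf.
  (* With [D] the set of numbers up to [p], the demand is an intersection over the finitely many [n]
     in [D] and subsets [s] of [D]. *)
  have /finite_fsetP[D DE] := finite_II p.+1.
  have pD i : (i <= p)%N -> [set` D] i by rewrite -DE.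
  have : U (\bigcap_(n in [set` D]) \bigcap_(s in [set` fpowerset D])
      [set k | large U B (S n) s -> ~ B s -> large U B (S n) (k |` s)%fset]).
    apply: filter_bigI => n _; apply: filter_bigI => s _.
    have [[Ls nBs]|nLs] := pselect (large U B (S n) s /\ ~ B s).
      have UL : U [set k | large U B (S n) (k |` s)%fset] by exact: large_nodeP.
      by apply: filterS UL => k Lk.
    by apply: filterS filterT => k _ Ls nBs; case: nLs.
  apply: filterS => k Dk n s np sp.
  have sD : s \in fpowerset D.
    by rewrite fpowersetE; apply/fsubsetP => i /sp/pD.
  exact: (Dk n (pD n np) s sD).
have [m [_ mnext]] := dependent_choice next 0%N.
have m_lt j : (m j < m j.+1)%N by case: (mnext j).
have m_mono : {homo m : i j / (i < j)%N} by exact: homo_ltn ltn_trans m_lt.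
have m_le : {homo m : i j / (i <= j)%N}.
  by move=> i j; rewrite leq_eqVlt => /predU1P[->//|/m_mono/ltnW].
have m_ge j : (j <= m j)%N by elim: j => // j IH; exact: leq_ltn_trans (m_lt j).
exists (range m).
  by apply: infinite_set_unbounded => p; exists (m p.+1); [exists p.+1|].
(* Every element of [t] is then some [m j.+1] with [n <= j <= m j], so its choice respected
   [S n]. *)
move=> n; exists (m n.+1) => t [Bt tM].
(* The truncations of [t] form the path from the root to the leaf [t], where largeness means
   membership in [S n]. *)
suff L q : large U B (S n) [fset i in t | (i < q)%N]%fset.
  apply: large_leafP Bt.
  suff <- : [fset i in t | (i < (\max_(i <- t) i).+1)%N]%fset = t by exact: L.
  apply/fsetP => i; rewrite !inE; case: (boolP (i \in t)) => //= ti.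
  by rewrite ltnS; exact: leq_bigmax_seq.
elim: q => [|q IH].
  suff -> : [fset i in t | (i < 0)%N]%fset = fset0 by exact: S0.
  by apply/fsetP => i; rewrite !inE andbF.
set s := [fset i in t | (i < q)%N]%fset in IH *.
have [tq|tNq] := boolP (q \in t); last first.
  suff -> : [fset i in t | (i < q.+1)%N]%fset = s by [].
  apply/fsetP => i; rewrite !inE ltnS leq_eqVlt.
  by case: eqVneq => // ->; rewrite (negPf tNq).
have -> : [fset i in t | (i < q.+1)%N]%fset = (q |` s)%fset.
  by apply/fsetP => i; rewrite !inE ltnS leq_eqVlt; case: eqVneq => // ->;
    rewrite tq.
have nBs : ~ B s.
  move=> Bs; suff st : s = t by move: tq; rewrite -st !inE ltnn andbF.
  by apply: Banti => //; apply/fsubsetP => i; rewrite !inE => /andP[].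
have [[j _ mjq] /negP] := tM q tq.
rewrite -leqNgt -mjq => mnj.
have nj : (n < j)%N.
  by rewrite ltnNge; apply/negP => /m_le mjn; have := m_lt n;
    rewrite ltnNge (leq_trans mnj mjn).
case: j mjq mnj nj => // j mjq mnj nj.
have [_] := mnext j; rewrite mjq; apply=> //; first exact: leq_trans (m_ge j).
move=> i; rewrite !inE => /andP[ti iq].
have [[l _ mli] _] := tM i ti.
rewrite -mli; apply: (m_le); rewrite -ltnS ltnNge; apply/negP => /m_le.
by rewrite mli mjq leqNgt iq.
Qed.

Theorem theorem4p4 (X : topologicalType) :
  compact [set: X] -> countably_bisequential X -> omega1_seq_compact X.
Proof.
move=> Xcpt Xbis alpha B bB _ f.
have [U [UU leU]] := ultraFilterLemma eventually_filter.
have Uinf p : U [set k | (p < k)%N] by apply: leU; exact: nbhs_infty_gt.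
have PU : ProperFilter U by exact: ultra_proper.
have VU := large_ultra _ _ bB UU Uinf.
set V := [set S | _] in VU.
have PV : ProperFilter V by exact: ultra_proper.
have [x [_ fVx]] := Xcpt (fmap f V) _ filterT.
(* The corestriction of [f] carries [V] to an ultrafilter on [range f], which is countable since
   there are countably many finite sets of naturals. *)
pose g s : range f := exist _ (f s) (mem_set (imageT f s)).
have gE (A : set (range f)) s : A (g s) -> (set_val @` A) (f s).
  by exists (g s).
have gV : UltraFilter (fmap g V).
  by apply: decisive_ultra => A; exact: (in_ultra_setVsetC (g @^-1` A)).
have clus : clusters_at [set set_val @` A | A in fmap g V] x.
  move=> _ [A VA <-] W Wx; apply: (fVx _ W) => //.
  by apply: (@filterS _ V _ (g @^-1` A)) => // s; exact: gE.
have fcnt : countable (range f).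
  by apply: sub_countable (card_image_le f _) _; exact: countableP.
have [A VA Ax] := Xbis (range f) _ fcnt gV x clus.
have [M Minf MA] := large_diagonal _ _ (fun n => g @^-1` A n) bB PU Uinf VA.
exists M => //; exists x => W oW Wx.
have [n AW] := Ax W oW Wx; have [p pA] := MA n.
exists p => _ [s [[Bs _] sM] <-].
by apply: AW; apply: gE; apply: pA.
Qed.
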